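(* Let $\hat M^\ell\in\mathbb{R}^{n_\ell\times n_{\ell-1}}$, $\ell\in[L]$, be given weight matrices, let $\tau>0$ and $T=4\tau$, and define $$\Lambda_{\mathrm{enc}}(\hat u)(t):=\hat u\,Q\!\left(t-\tfrac T2\right)\ (t\in[0,T]),\qquad \Lambda_{\mathrm{dec}}(y):=y\!\left(\tfrac T2\right).$$ Let all switches be closed, i.e. for every $\ell\in[L]$ the switch matrix $S^\ell$ is constantly the all-ones matrix. Then for every $\hat u\in\mathbb{R}^{n_0}$ and all initial fluxes $\varphi^\ell_0\in\mathbb{R}^{n_\ell\times n_{\ell-1}}$ satisfying $W(\varphi^\ell_0)=\hat M^\ell$ for all $\ell\in[L]$, the solution on $[0,T]$ of the circuit equations with input $u(t)=\Lambda_{\mathrm{enc}}(\hat u)(t)$ and initial conditions $\varphi^\ell(0)=\varphi^\ell_0$ satisfies: 1. $\Lambda_{\mathrm{dec}}(y)=h(\hat u)$; 2. $\varphi^\ell(T)=\varphi^\ell_0$ for all $\ell\in[L]$.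
   Context: Notation: $[n]=\{1,\dots,n\}$; $\mathbb 1_m\in\mathbb{R}^m$ is the all-ones column vector; $\odot$ is the entrywise (Hadamard) product. $L\ge 1$ and $n_0,\dots,n_L$ are positive integers. Activation function: $\sigma:\mathbb{R}\to\mathbb{R}$ is continuously differentiable, odd, strictly monotone (meaning $(\sigma(x)-\sigma(y))(x-y)>0$ for all $x\ne y$) and $\eta$-Lipschitz continuous for some $\eta>0$. $\sigma^\ell:\mathbb{R}^{n_\ell}\to\mathbb{R}^{n_\ell}$ is the entrywise application of $\sigma$. Memristors: $g:\mathbb{R}\to\mathbb{R}$ is continuously differentiable with $W(\varphi):=\frac{dg(\varphi)}{d\varphi}>0$ for all $\varphi\in\mathbb{R}$; $W$ is strictly monotone (meaning $(W(x)-W(y))(x-y)>0$ for all $x\ne y$), $\beta$-Lipschitz continuous for some $\beta>0$, and there are constants $W_{\max}\ge W_{\min}>0$ with $W_{\max}\ge W(x)\ge W_{\min}$ for all $x\in\mathbb{R}$. For a matrix $\varphi$, $W(\varphi)$ is the matrix obtained by applying $W$ entrywise. Artificial neural network (ANN): for weight matrices $\hat M^1,\dots,\hat M^L$, the function $h:\mathbb{R}^{n_0}\to\mathbb{R}^{n_L}$ is $h(\hat u)=a^L$, where $a^0=\hat u$ and $a^\ell=\sigma^\ell(\hat M^\ell a^{\ell-1})$ for $\ell\in[L]$. Circuit equations: with flux matrices $\varphi^\ell(t)\in\mathbb{R}^{n_\ell\times n_{\ell-1}}$, switch matrices $S^\ell(t)\in\{0,1\}^{n_\ell\times n_{\ell-1}}$,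 input $u(t)\in\mathbb{R}^{n_0}$ and output $y(t)\in\mathbb{R}^{n_L}$, $$P^0=u,\qquad \tfrac{d}{dt}\varphi^\ell=S^\ell\odot(\mathbb 1_{n_\ell}(P^{\ell-1})^\top),\quad \bar J^\ell=(W(\varphi^\ell)\odot S^\ell)P^{\ell-1},\quad P^\ell=\sigma^\ell(\bar J^\ell)\ \ (\ell\in[L]),\qquad y=P^L.$$ The differential equations are understood in integrated form, $\varphi^\ell(t)=\varphi^\ell(0)+\int_0^t S^\ell\odot(\mathbb 1_{n_\ell}(P^{\ell-1})^\top)\,ds$, since signals may be discontinuous; the relations for $\bar J^\ell,P^\ell,y$ hold pointwise in $t$. Block signal: for $\tau>0$, $Q(t)=0$ for $t<-2\tau$; $Q(t)=-1$ for $t\in[-2\tau,-\tau)$; $Q(t)=1$ for $t\in[-\tau,\tau]$; $Q(t)=-1$ for $t\in(\tau,2\tau]$; $Q(t)=0$ for $t>2\tau$. *)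

(* Defs.v *)
From mathcomp Require Import all_boot all_order all_algebra.
From mathcomp Require Import all_classical all_reals all_analysis.

Set Implicit Arguments.
Unset Strict Implicit.
Unset Printing Implicit Defensive.

Import Order.TTheory GRing.Theory Num.Theory numFieldNormedType.Exports.

Local Open Scope classical_set_scope.
Local Open Scope ring_scope.

Definition strictly_monotone (R : realType) (f : R -> R) : Prop :=
  forall x y : R, x != y -> 0 < (f x - f y) * (x - y).

Definition continuously_differentiable (R : realType) (f : R -> R) : Prop :=
  (forall x : R, derivable f x 1) /\ continuous (derive1 f).

Definition activation (R : realType) (sigma : R -> R) : Prop :=
  [/\ continuously_differentiable sigma,
      forall x : R, sigma (- x) = - sigma x,
      strictly_monotone sigma &
      exists2 eta : R, 0 < eta & eta.-lipschitz sigma].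

(* g maps flux to charge; the memductance is W = derive1 g. *)
Definition memristor (R : realType) (g : R -> R) : Prop :=
  [/\ continuously_differentiable g,
      forall x : R, 0 < derive1 g x,
      strictly_monotone (derive1 g),
      exists2 beta : R, 0 < beta & beta.-lipschitz (derive1 g) &
      exists Wmin Wmax : R, 0 < Wmin <= Wmax /\
        forall x : R, Wmin <= derive1 g x <= Wmax].

(* Layer l in {1, ..., L} has the index k = l - 1 for its weights, fluxes,
   switches and currents, so that these are n_(k+1) x n_k matrices and
   n_(k+1)-vectors; activations and potentials keep the index l in
   {0, ..., L}.  Families are total on nat; their values beyond L are
   irrelevant. *)

Fixpoint ann_layer (R : realType) (n : nat -> nat) (sigma : R -> R)
    (M : forall k : nat, 'M[R]_(n k.+1, n k)) (u : 'cV[R]_(n 0%N)) (l : nat) :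
    'cV[R]_(n l) :=
  if l is k.+1 then map_mx sigma (M k *m ann_layer sigma M u k) else u.

Definition ann (R : realType) (n : nat -> nat) (L : nat) (sigma : R -> R)
    (M : forall k : nat, 'M[R]_(n k.+1, n k)) (u : 'cV[R]_(n 0%N)) :
    'cV[R]_(n L) :=
  ann_layer sigma M u L.

Definition hadamard (R : realType) (m p : nat) (A B : 'M[R]_(m, p)) :
    'M[R]_(m, p) :=
  map2_mx *%R A B.

(* Entries of switch matrices: true (closed) is 1, false (open) is 0. *)
Definition switch_mx (R : realType) (m p : nat) (S : 'M[bool]_(m, p)) :
    'M[R]_(m, p) :=
  map_mx (fun b : bool => b%:R) S.

Record circuit_signals (R : realType) (n : nat -> nat) (L : nat) :=
  CircuitSignals {
    flux : forall k : nat, R -> 'M[R]_(n k.+1, n k);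
    current : forall k : nat, R -> 'cV[R]_(n k.+1);
    potential : forall l : nat, R -> 'cV[R]_(n l);
    output : R -> 'cV[R]_(n L)
  }.

(* Entry (i, j) is P_j if the switch (i, j) is closed and 0 otherwise. *)
Definition flux_rate (R : realType) (m p : nat) (S : 'M[bool]_(m, p))
    (P : 'cV[R]_p) : 'M[R]_(m, p) :=
  hadamard (switch_mx R S) ((const_mx 1 : 'cV[R]_m) *m P^T).

Definition circuit_solution (R : realType) (n : nat -> nat) (L : nat)
    (sigma g : R -> R) (T : R)
    (S : forall k : nat, R -> 'M[bool]_(n k.+1, n k))
    (u : R -> 'cV[R]_(n 0%N)) (phi0 : forall k : nat, 'M[R]_(n k.+1, n k))
    (X : circuit_signals R n L) : Prop :=
  [/\ forall k : nat, (k < L)%N -> flux X k 0 = phi0 k,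
      forall k : nat, (k < L)%N -> forall i j,
        lebesgue_measure.-integrable `[0, T]
          (fun s : R => (flux_rate (S k s) (potential X k s) i j)%:E),
      forall (k : nat) (t : R), (k < L)%N -> 0 <= t <= T ->
        flux X k t = flux X k 0 +
          \matrix_(i, j) \int[lebesgue_measure]_(s in `[0, t])
                            flux_rate (S k s) (potential X k s) i j &
      forall t : R, 0 <= t <= T ->
        [/\ potential X 0%N t = u t,
            forall k : nat, (k < L)%N ->
              current X k t =
              hadamard (map_mx (derive1 g) (flux X k t)) (switch_mx R (S k t))
                *m potential X k t,
            forall k : nat, (k < L)%N ->
              potential X k.+1 t = map_mx sigma (current X k t) &
            output X t = potential X L t]].

(* Equality of the signals that the circuit equations determine on [0, T]. *)
Definition same_signals (R : realType) (n : nat -> nat) (L : nat) (T : R)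
    (X Y : circuit_signals R n L) : Prop :=
  forall t : R, 0 <= t <= T ->
    [/\ forall k : nat, (k < L)%N -> flux X k t = flux Y k t,
        forall k : nat, (k < L)%N -> current X k t = current Y k t,
        forall l : nat, (l <= L)%N -> potential X l t = potential Y l t &
        output X t = output Y t].

Definition block_signal (R : realType) (tau t : R) : R :=
  if t < - (2 * tau) then 0
  else if t < - tau then -1
  else if t <= tau then 1
  else if t <= 2 * tau then -1
  else 0.

Definition Lambda_enc (R : realType) (m : nat) (tau T : R) (u : 'cV[R]_m) :
    R -> 'cV[R]_m :=
  fun t : R => block_signal tau (t - T / 2) *: u.

Definition Lambda_dec (R : realType) (m : nat) (T : R) (y : R -> 'cV[R]_m) :
    'cV[R]_m :=
  y (T / 2).

(* Main.v *)
Require Import Defs.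
From mathcomp Require Import all_boot all_order all_algebra.
From mathcomp Require Import all_classical all_reals all_analysis.
From mathcomp Require Import measurable_realfun ring lra.

(** The block signal, shifted to [0, 4 tau], is -1, then 1, then -1, changing
    sign at tau and at 3 tau.  Hence the input is odd about each of these two
    times, on a window of half-width tau (the value at the centre itself is
    excluded, since the signal is 1 there).

    This oddness propagates through the layers.  If every component P_j of the
    potential of a layer is odd about c, then its primitive, which is the flux
    increment of column j, is even about c ([primitive_symmetric]); so the
    conductances W(phi) are even about c, the currents W(phi) P are odd, and the
    next potential is odd because sigma is ([closed_layer_odd]).  Evenness of
    the fluxes about tau identifies their values at 0 and 2 tau, and evenness
    about 3 tau those at 2 tau and 4 tau: every flux is back at its initial
    value at both 2 tau and 4 tau ([closed_flux_revisit]).  The first instant is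
    the read-out time T / 2, where the input equals the encoded vector and the
    conductances equal the weights, so that the circuit evaluates the network
    ([closed_potential_ann]); the second is T.

    Existence and uniqueness need no fixed point: a closed switch lets the flux
    of a layer depend on the potential of the preceding layer only, so the
    circuit equations are solved by recursion on the layers
    ([closed_signals_solution], [solution_closed_signals]).  The only analytic
    point is that each potential is integrable: it is measurable because the
    flux is continuous in time, and dominated by the previous potential because
    sigma is Lipschitz with sigma 0 = 0 and W is bounded
    ([integrable_closed_layer]). *)

Set Implicit Arguments.
Unset Strict Implicit.
Unset Printing Implicit Defensive.

Import Order.TTheory GRing.Theory Num.Theory numFieldNormedType.Exports.

Local Open Scope classical_set_scope.
Local Open Scope ring_scope.

(** * Reflection of Lebesgue integrals *)

(** Typed on [measurableTypeR], the carrier of [lebesgue_measure], so that its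
    pushforward can be compared with [lebesgue_measure]. *)
Definition reflection (R : realType) (c : R) :
  measurableTypeR R -> measurableTypeR R := fun x => c - x.

Lemma measurable_reflection (R : realType) (c : R) :
  measurable_fun setT (reflection c).
Proof. exact: measurable_funB. Qed.

Lemma lebesgue_measure_reflect (R : realType) (c : R) (A : set R) :
  measurable A ->
  pushforward lebesgue_measure (reflection c) A = lebesgue_measure A.
Proof.
move=> mA; apply/esym/lebesgue_measure_unique => //= [|_ _ [[a b]] _ <-].
  exact: measurable_reflection.
rewrite /pushforward.
have -> : reflection c @^-1` [set` `]a, b]] = `[c - b, c - a[%classic.
  apply/seteqP; split=> x /=; rewrite !in_itv /= /reflection => /andP[? ?];
    apply/andP; split; lra.
rewrite !lebesgue_measure_itv/= !lte_fin.
by rewrite ltrD2l ltrN2 -!EFinB; congr (if _ then (_%:E) else _); ring.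
Qed.

(** Both parts of f are transported along the pushforward separately, so that
    integrability of the reflected function need not be known beforehand. *)
Lemma integral_reflect (R : realType) (c : R) (D : set R) (f : R -> \bar R) :
  measurable D -> measurable_fun D f ->
  (\int[lebesgue_measure]_(x in D) f x =
  \int[lebesgue_measure]_(x in [set x | D (c - x)%R]) f (c - x)%R)%E.
Proof.
move=> mD mf.
have ge0_reflect (h : R -> \bar R) :
    measurable_fun D h -> (forall x, 0 <= h x)%E ->
    (\int[lebesgue_measure]_(x in D) h x =
    \int[lebesgue_measure]_(x in reflection c @^-1` D) (h \o reflection c) x)%E.
  have mc := measurable_reflection c.
  move=> mh h0; rewrite -(ge0_integral_pushforward mc lebesgue_measure)//.
  apply: eq_measure_integral => A mA _.
  exact/esym/lebesgue_measure_reflect.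
rewrite [LHS]integralE [RHS]integralE.
rewrite (ge0_reflect _ (measurable_funepos mf))//.
rewrite (ge0_reflect _ (measurable_funeneg mf))//.
by rewrite -funepos_comp -funeneg_comp.
Qed.

(** The reflection about c maps the right half of the interval onto the left
    half and negates f, so the two halves cancel; the centre has measure zero
    and f is unconstrained there. *)
Lemma Rintegral_antisymmetric (R : realType) (c r : R) (f : R -> R) : 0 <= r ->
  lebesgue_measure.-integrable `[c - r, c + r] (EFin \o f) ->
  (forall s, 0 < s <= r -> f (c - s) = - f (c + s)) ->
  \int[lebesgue_measure]_(x in `[c - r, c + r]) f x = 0.
Proof.
move=> r0 intf f_odd.
rewrite -[LHS](subrK (\int[lebesgue_measure]_(x in `[c - r, c]) f x)).
rewrite Rintegral_itvB ?bnd_simp //; try lra.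
have intl : lebesgue_measure.-integrable `[c - r, c[ (EFin \o f).
  by apply: integrableS intf => //; apply: subset_itvl; rewrite bnd_simp; lra.
have intr : lebesgue_measure.-integrable `]c, c + r] (EFin \o f).
  by apply: integrableS intf => //; apply: subset_itvr; rewrite bnd_simp; lra.
rewrite -(Rintegral_itv_bndo_bndc intl).
have -> : \int[lebesgue_measure]_(x in `[c - r, c[) f x =
    \int[lebesgue_measure]_(x in `]c, c + r]) (-1 * f x).
  congr fine; rewrite (integral_reflect (2 * c)) //; last first.
    exact: measurable_int intl.
  have -> : [set x | `[(c - r)%R, c[%classic (2 * c - x)%R] =
      `]c, (c + r)%R]%classic.
    apply/seteqP; split=> x /=; rewrite !in_itv /= => /andP[? ?];
      apply/andP; split; lra.
  apply: eq_integral => x; rewrite inE /= in_itv /= => /andP[cx xr].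
  congr EFin; rewrite mulN1r (_ : 2 * c - x = c - (x - c)); last ring.
  by rewrite f_odd ?(subrKC c) //; lra.
by rewrite RintegralZl //; ring.
Qed.

(** The two values differ by the integral over the interval from c - t to c + t,
    where f is antisymmetric. *)
Lemma primitive_symmetric (R : realType) (c r t : R) (f : R -> R) :
  r <= c -> 0 <= t <= r ->
  lebesgue_measure.-integrable `[0, c + r] (EFin \o f) ->
  (forall s, 0 < s <= r -> f (c - s) = - f (c + s)) ->
  \int[lebesgue_measure]_(x in `[0, c - t]) f x =
  \int[lebesgue_measure]_(x in `[0, c + t]) f x.
Proof.
move=> rc /andP[t0 tr] intf f_odd.
have intft : lebesgue_measure.-integrable `[0, c + t] (EFin \o f).
  by apply: integrableS intf => //; apply: subset_itvl; rewrite bnd_simp; lra.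
have intc : lebesgue_measure.-integrable `[c - t, c + t] (EFin \o f).
  by apply: integrableS intft => //; apply: subset_itvr; rewrite bnd_simp; lra.
have into : lebesgue_measure.-integrable `]c - t, c + t] (EFin \o f).
  by apply: integrableS intc => //; apply: subset_itvr; rewrite bnd_simp; lra.
apply/esym/eqP; rewrite -subr_eq0 Rintegral_itvB // ?bnd_simp; try lra.
rewrite Rintegral_itv_obnd_cbnd// Rintegral_antisymmetric// => s /andP[s0 st].
by rewrite f_odd //; lra.
Qed.

(** * Layers with closed switches *)

(** With all switches closed the flux rate in row i and column j is P_j,
    whatever i is: this makes the layer equations explicit in the incoming potential. *)
Definition closed_flux (R : realType) (m p : nat) (phi : 'M[R]_(m, p))
    (P : R -> 'cV[R]_p) (t : R) : 'M[R]_(m, p) :=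
  phi + \matrix_(i, j) \int[lebesgue_measure]_(s in `[0, t]) P s j 0.

Definition closed_current (R : realType) (m p : nat) (W : R -> R)
    (phi : 'M[R]_(m, p)) (P : R -> 'cV[R]_p) (t : R) : 'cV[R]_m :=
  map_mx W (closed_flux phi P t) *m P t.

Definition closed_layer (R : realType) (m p : nat) (sigma W : R -> R)
    (phi : 'M[R]_(m, p)) (P : R -> 'cV[R]_p) (t : R) : 'cV[R]_m :=
  map_mx sigma (closed_current W phi P t).

Fixpoint closed_potential (R : realType) (n : nat -> nat) (sigma W : R -> R)
    (phi0 : forall k : nat, 'M[R]_(n k.+1, n k)) (u : R -> 'cV[R]_(n 0%N))
    (l : nat) : R -> 'cV[R]_(n l) :=
  if l is k.+1
  then closed_layer sigma W (phi0 k) (closed_potential sigma W phi0 u k)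
  else u.

Definition closed_signals (R : realType) (n : nat -> nat) (L : nat)
    (sigma W : R -> R) (phi0 : forall k : nat, 'M[R]_(n k.+1, n k))
    (u : R -> 'cV[R]_(n 0%N)) : circuit_signals R n L :=
  let P := closed_potential sigma W phi0 u in
  CircuitSignals (fun k => closed_flux (phi0 k) (P k))
    (fun k => closed_current W (phi0 k) (P k)) P (P L).

Definition integrable_cV (R : realType) (p : nat) (T : R) (P : R -> 'cV[R]_p) :=
  forall j, lebesgue_measure.-integrable `[0, T] (fun s => (P s j 0)%:E).

Lemma integrable_cVW (R : realType) (p : nat) (T T' : R) (P : R -> 'cV[R]_p) :
  T <= T' -> integrable_cV T' P -> integrable_cV T P.
Proof.
move=> TT' intP j; apply: integrableS (intP j) => //.
by apply: subset_itvl; rewrite bnd_simp.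
Qed.

(** The next potential is bounded by a constant multiple of the sum of the
    |P_j|, hence integrable as soon as it is measurable; measurability rests on
    the continuity of the flux, a primitive of an integrable function. *)
Lemma integrable_closed_layer (R : realType) (m p : nat) (sigma W : R -> R)
    (T eta Wmax : R) (phi : 'M[R]_(m, p)) (P : R -> 'cV[R]_p) :
  0 <= T -> 0 <= eta -> continuous sigma -> continuous W ->
  (forall x, `|sigma x| <= eta * `|x|) -> (forall x, `|W x| <= Wmax) ->
  integrable_cV T P -> integrable_cV T (closed_layer sigma W phi P).
Proof.
move=> T0 eta0 csigma cW sigma_le W_le intP i.
have mP j : measurable_fun `[0, T] (fun t => P t j 0).
  by apply/measurable_EFinP; exact: measurable_int (intP j).
have mflux j : measurable_fun `[0, T] (fun t => closed_flux phi P t i j).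
  rewrite /closed_flux; under [X in measurable_fun _ X]eq_fun do rewrite !mxE.
  apply: measurable_funD; first exact: measurable_cst.
  apply: subspace_continuous_measurable_fun => //.
  exact: (parameterized_integral_continuous T0 (intP j)).
have mcurrent : measurable_fun `[0, T] (fun t => closed_current W phi P t i 0).
  rewrite /closed_current; under [X in measurable_fun _ X]eq_fun do rewrite mxE.
  apply: measurable_sum => j.
  under [X in measurable_fun _ X]eq_fun do rewrite mxE.
  apply: measurable_funM => //.
  by apply: (measurableT_comp _ (mflux j)); exact: continuous_measurable_fun.
apply: (@le_integrable _ _ _ lebesgue_measure `[0, T]%classic _ _
    (fun t => (eta * \sum_j (Wmax * `|P t j 0|))%:E)) => //.
- apply/measurable_EFinP; rewrite /closed_layer.
  under [X in measurable_fun _ X]eq_fun do rewrite mxE.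
  by apply: (measurableT_comp _ mcurrent); exact: continuous_measurable_fun.
- move=> t _; rewrite /= lee_fin mxE (le_trans (sigma_le _)) //.
  rewrite [leRHS]ger0_norm; last first.
    rewrite mulr_ge0 // sumr_ge0 // => j _; rewrite mulr_ge0 //.
    exact: le_trans (normr_ge0 _) (W_le 0).
  rewrite ler_wpM2l // mxE (le_trans (ler_norm_sum _ _ _)) // ler_sum // => j _.
  by rewrite normrM mxE ler_wpM2r.
- under [X in _.-integrable _ X]eq_fun do rewrite EFinM -sumEFin.
  apply: integrableZl => //; apply: integrable_sum => // j _.
  under [X in _.-integrable _ X]eq_fun do rewrite EFinM.
  by apply: integrableZl => //; exact: integrable_norm (intP j).
Qed.

(** The centre, s = 0, is excluded because the block signal is nonzero at its
    jumps; being a null set, it does not affect the fluxes. *)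
Definition odd_about (R : realType) (p : nat) (c r : R) (P : R -> 'cV[R]_p) :=
  forall s, 0 < s <= r -> P (c - s) = - P (c + s).

Lemma closed_flux0 (R : realType) (m p : nat) (phi : 'M[R]_(m, p))
    (P : R -> 'cV[R]_p) : closed_flux phi P 0 = phi.
Proof. by apply/matrixP => i j; rewrite !mxE set_itv1 Rintegral_set1 addr0. Qed.

Lemma closed_flux_symmetric (R : realType) (m p : nat) (phi : 'M[R]_(m, p))
    (P : R -> 'cV[R]_p) (c r t : R) :
  r <= c -> 0 <= t <= r -> integrable_cV (c + r) P -> odd_about c r P ->
  closed_flux phi P (c - t) = closed_flux phi P (c + t).
Proof.
move=> rc tr intP P_odd; apply/matrixP => i j; rewrite !mxE; congr +%R.
by apply: primitive_symmetric rc tr (intP j) _ => s /P_odd ->; rewrite mxE.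
Qed.

(** Even conductances times odd potentials give odd currents, and an odd
    activation keeps them odd. *)
Lemma closed_layer_odd (R : realType) (m p : nat) (sigma W : R -> R)
    (phi : 'M[R]_(m, p)) (P : R -> 'cV[R]_p) (c r : R) :
  (forall x, sigma (- x) = - sigma x) -> r <= c -> integrable_cV (c + r) P ->
  odd_about c r P -> odd_about c r (closed_layer sigma W phi P).
Proof.
move=> sigma_odd rc intP P_odd s /andP[s0 sr].
have s_itv : 0 <= s <= r by rewrite (ltW s0).
rewrite /closed_layer /closed_current (closed_flux_symmetric _ rc s_itv) //.
rewrite P_odd ?s0 // mulmxN.
by apply/matrixP => i j; move: (_ *m _) => A; rewrite !mxE sigma_odd.
Qed.

(** Two reflections at their extreme points: 0 and 2 tau are mirror images about
    tau, and 2 tau and 4 tau about 3 tau. *)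
Lemma closed_flux_revisit (R : realType) (m p : nat) (phi : 'M[R]_(m, p))
    (P : R -> 'cV[R]_p) (tau : R) :
  0 <= tau -> integrable_cV (4 * tau) P ->
  odd_about tau tau P -> odd_about (3 * tau) tau P ->
  closed_flux phi P (2 * tau) = phi /\ closed_flux phi P (4 * tau) = phi.
Proof.
move=> tau0 intP odd1 odd3.
have flux2 : closed_flux phi P (2 * tau) = phi.
  rewrite -[RHS](closed_flux0 phi P) -(subrr tau).
  rewrite (_ : 2 * tau = tau + tau); last ring.
  rewrite (closed_flux_symmetric _ _ _ _ odd1) ?lexx ?tau0 //.
  by apply: integrable_cVW intP; lra.
split=> //; rewrite -[RHS]flux2.
rewrite (_ : 4 * tau = 3 * tau + tau); last ring.
rewrite (_ : 2 * tau = 3 * tau - tau); last ring.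
rewrite (closed_flux_symmetric _ _ _ _ odd3) ?tau0 ?lexx //; try lra.
by apply: integrable_cVW intP; lra.
Qed.

(** * The block encoding *)

Lemma block_signal_shifted (R : realType) (tau t : R) : 0 <= t <= 4 * tau ->
  block_signal tau (t - 4 * tau / 2) = if tau <= t <= 3 * tau then 1 else -1.
Proof.
move=> /andP[t0 tT]; rewrite /block_signal.
rewrite ifF; last by apply/negbTE; rewrite -leNgt; lra.
case: ltP => [?|le_tau].
  by rewrite ifF //; apply/andP => -[]; lra.
case: leP => [?|gt_3tau]; first by rewrite ifT //; apply/andP; split; lra.
rewrite ifT; last lra.
by rewrite ifF //; apply/andP => -[]; lra.
Qed.

Lemma integrable_Lambda_enc (R : realType) (m : nat) (tau T : R)
    (u : 'cV[R]_m) :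
  integrable_cV T (Lambda_enc tau T u).
Proof.
move=> j; apply: measurable_bounded_integrable => //.
- by rewrite /= lebesgue_measure_itv; case: ifP; rewrite ?ltry // -EFinB ltry.
- rewrite /Lambda_enc /block_signal.
  under [X in measurable_fun _ X]eq_fun do rewrite mxE.
  have mshift : measurable_fun [set: R] (fun t : R => t - T / 2).
    exact: measurable_funB.
  apply: measurable_funTS; apply: measurable_funM => //.
  do ?[apply: measurable_fun_ifT => //];
    by [apply: measurable_fun_ltr | apply: measurable_fun_ler].
- exists `|u j 0|; split; first exact: num_real.
  move=> B uB t _ /=; apply: le_trans (ltW uB).
  rewrite mxE normrM ler_piMl // /block_signal.
  by do ?case: ifP => _; rewrite ?normrN ?normr0 ?normr1.
Qed.

Lemma Lambda_enc_odd (R : realType) (m : nat) (tau c : R) (u : 'cV[R]_m) :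
  0 < tau -> c = tau \/ c = 3 * tau ->
  odd_about c tau (Lambda_enc tau (4 * tau) u).
Proof.
move=> tau_gt0 c_eq s /andP[s0 st].
have c_itv : 0 <= c - tau /\ c + tau <= 4 * tau by case: c_eq => ->; lra.
rewrite /Lambda_enc !block_signal_shifted; try by apply/andP; split; lra.
rewrite -scaleNr; congr (_ *: _); case: c_eq => ->.
- rewrite ifF; last by apply/andP => -[]; lra.
  by rewrite ifT //; apply/andP; split; lra.
- rewrite ifT ?opprK; last by apply/andP; split; lra.
  by rewrite ifF ?opprK //; apply/andP => -[]; lra.
Qed.

Lemma Lambda_enc_mid (R : realType) (m : nat) (tau : R) (u : 'cV[R]_m) :
  0 < tau -> Lambda_enc tau (4 * tau) u (2 * tau) = u.
Proof.
move=> tau_gt0; rewrite /Lambda_enc block_signal_shifted; last first.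
  by apply/andP; split; lra.
by rewrite ifT ?scale1r //; apply/andP; split; lra.
Qed.

(** * Solving the circuit equations *)

Lemma flux_rate_closed (R : realType) (m p : nat) (P : 'cV[R]_p) :
  flux_rate (const_mx true : 'M[bool]_(m, p)) P = \matrix_(i, j) P j 0.
Proof.
by apply/matrixP => i j; rewrite !mxE big_ord1 !mxE !mul1r.
Qed.

Lemma hadamard_closed (R : realType) (m p : nat) (A : 'M[R]_(m, p)) :
  hadamard A (switch_mx R (const_mx true)) = A.
Proof. by apply/matrixP => i j; rewrite !mxE mulr1. Qed.

Section closed_circuit.
Variables (R : realType) (n : nat -> nat) (L : nat) (sigma g : R -> R) (T : R).
Variable S : forall k : nat, R -> 'M[bool]_(n k.+1, n k).
Hypothesis S_closed : forall (k : nat) (t : R), (k < L)%N -> 0 <= t <= T ->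
  S k t = const_mx true.
Variable u : R -> 'cV[R]_(n 0%N).
Variable phi0 : forall k : nat, 'M[R]_(n k.+1, n k).
Local Notation W := (derive1 g).
Local Notation P := (closed_potential sigma W phi0 u).

Lemma integral_flux_rate_closed (k : nat) (t : R) (Q : R -> 'cV[R]_(n k)) :
  (k < L)%N -> t <= T ->
  \matrix_(i, j) \int[lebesgue_measure]_(s in `[0, t])
    flux_rate (S k s) (Q s) i j =
  \matrix_(i, j) \int[lebesgue_measure]_(s in `[0, t]) Q s j 0.
Proof.
move=> kL tT; apply/matrixP => i j; rewrite !mxE; apply: eq_Rintegral => s.
rewrite inE /= in_itv /= => /andP[s0 st].
by rewrite S_closed // ?flux_rate_closed ?mxE // s0 (le_trans st).
Qed.

Lemma closed_signals_solution :
  (forall k, integrable_cV T (P k)) ->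
  circuit_solution sigma g T S u phi0 (closed_signals L sigma W phi0 u).
Proof.
move=> intP; split=> [k kL|k kL i j|k t kL /andP[t0 tT]|t tT] /=.
- exact: closed_flux0.
- apply: eq_integrable (intP k j) => // s; rewrite inE /= in_itv /= => sT.
  by rewrite S_closed // flux_rate_closed mxE.
- by rewrite closed_flux0 integral_flux_rate_closed.
- by split=> // k kL; rewrite S_closed // hadamard_closed.
Qed.

(** Induction on the layers: the flux and the current of a layer at time t
    involve only the preceding potential, on [0, t]. *)
Lemma solution_closed_signals (X : circuit_signals R n L) :
  circuit_solution sigma g T S u phi0 X ->
  same_signals T X (closed_signals L sigma W phi0 u).
Proof.
case=> flux0 _ fluxE pointwise.
have flux_closed k t : (k < L)%N ->
    (forall s, 0 <= s <= T -> potential X k s = P k s) -> 0 <= t <= T ->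
    flux X k t = closed_flux (phi0 k) (P k) t.
  move=> kL potE /andP[t0 tT].
  rewrite fluxE ?t0 // flux0 // integral_flux_rate_closed //; congr +%R.
  apply/matrixP => i j; rewrite !mxE; apply: eq_Rintegral => s.
  by rewrite inE /= in_itv /= => /andP[s0 st]; rewrite potE // s0 (le_trans st).
have current_closed k t : (k < L)%N ->
    (forall s, 0 <= s <= T -> potential X k s = P k s) -> 0 <= t <= T ->
    current X k t = closed_current W (phi0 k) (P k) t.
  move=> kL potE tT; have [_ currentE _ _] := pointwise t tT.
  by rewrite currentE // S_closed // hadamard_closed flux_closed // potE.
have pot_closed l : (l <= L)%N ->
    forall t, 0 <= t <= T -> potential X l t = P l t.
  elim: l => [_|k IH kL] t tT; have [pot0 _ potS _] := pointwise t tT => //.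
  by rewrite potS // current_closed // => s; exact: IH (ltnW kL) s.
move=> t tT; have [_ _ _ outE] := pointwise t tT.
split=> [k kL|k kL|l lL|] /=.
- by apply: flux_closed => // s; exact: pot_closed (ltnW kL) s.
- by apply: current_closed => // s; exact: pot_closed (ltnW kL) s.
- exact: pot_closed.
- by rewrite outE pot_closed.
Qed.

End closed_circuit.

(** Where the fluxes have their initial values the conductances are the weights,
    and the layer equations at that instant are those of the network. *)
Lemma closed_potential_ann (R : realType) (n : nat -> nat) (sigma W : R -> R)
    (phi0 : forall k : nat, 'M[R]_(n k.+1, n k)) (u : R -> 'cV[R]_(n 0%N))
    (M : forall k : nat, 'M[R]_(n k.+1, n k)) (t : R) (L : nat) :
  (forall k, (k < L)%N -> map_mx W (phi0 k) = M k) ->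
  (forall k, (k < L)%N ->
    closed_flux (phi0 k) (closed_potential sigma W phi0 u k) t = phi0 k) ->
  closed_potential sigma W phi0 u L t = ann L sigma M (u t).
Proof.
rewrite /ann; elim: L => [//|L IH] phi0M fluxE /=.
rewrite /closed_layer /closed_current fluxE // phi0M //.
by rewrite IH // => k kL; [apply: phi0M | apply: fluxE]; exact: ltnW.
Qed.

(** * Decoding and return of the fluxes *)

Lemma continuously_differentiable_continuous (R : realType) (f : R -> R) :
  continuously_differentiable f -> continuous f.
Proof.
by case=> df _ x; apply: differentiable_continuous; exact/derivable1_diffP.
Qed.

Lemma lipschitz_odd_le (R : realType) (f : R -> R) (eta : R) :
  (forall x, f (- x) = - f x) -> eta.-lipschitz f ->
  forall x, `|f x| <= eta * `|x|.
Proof.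
move=> f_odd f_lip x; have f0 : f 0 = 0 by have := f_odd 0; rewrite oppr0; lra.
by have /= := f_lip (x, 0) (conj I I); rewrite /= f0 !subr0.
Qed.

Theorem theorem1 (R : realType) (L : nat) (n : nat -> nat) (sigma g : R -> R)
    (hL : (1 <= L)%N) (hn : forall l : nat, (l <= L)%N -> (0 < n l)%N)
    (hsigma : activation sigma) (hg : memristor g)
    (M : forall k : nat, 'M[R]_(n k.+1, n k))
    (tau T : R) (htau : 0 < tau) (hT : T = 4 * tau)
    (S : forall k : nat, R -> 'M[bool]_(n k.+1, n k))
    (hS : forall (k : nat) (t : R), (k < L)%N -> 0 <= t <= T ->
      S k t = const_mx true)
    (uhat : 'cV[R]_(n 0%N))
    (phi0 : forall k : nat, 'M[R]_(n k.+1, n k))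
    (hphi0 : forall k : nat, (k < L)%N -> map_mx (derive1 g) (phi0 k) = M k) :
  let solution :=
    @circuit_solution R n L sigma g T S (Lambda_enc tau T uhat) phi0 in
  [/\ exists X : circuit_signals R n L, solution X,
      forall X Y : circuit_signals R n L,
        solution X -> solution Y -> same_signals T X Y &
      forall X : circuit_signals R n L, solution X ->
        Lambda_dec T (output X) = ann L sigma M uhat /\
        forall k : nat, (k < L)%N -> flux X k T = phi0 k].
Proof.
move=> solution; set u := Lambda_enc tau T uhat in solution *.
have T0 : 0 <= T by lra.
have [sigma_C1 sigma_odd _ [eta eta0 sigma_lip]] := hsigma.
have [[_ cW] W_gt0 _ _ [Wmin [Wmax [_ W_bounds]]]] := hg.
have W_le x : `|derive1 g x| <= Wmax.
  by rewrite gtr0_norm //; case/andP: (W_bounds x).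
set P := closed_potential sigma (derive1 g) phi0 u.
have intP l : integrable_cV T (P l).
  elim: l => [|k IH]; first exact: integrable_Lambda_enc.
  apply: (integrable_closed_layer _ T0 (ltW eta0) _ cW _ W_le IH).
    exact: continuously_differentiable_continuous.
  exact: lipschitz_odd_le.
have P_odd c l : c = tau \/ c = 3 * tau -> odd_about c tau (P l).
  move=> c_eq; have c_itv : tau <= c /\ c + tau <= T by case: c_eq => ->; lra.
  elim: l => [|k IH] /=; first by rewrite /P /= /u hT; exact: Lambda_enc_odd.
  apply: closed_layer_odd IH => //; first by case: c_itv.
  by apply: integrable_cVW (intP k); case: c_itv.
have fluxE k : closed_flux (phi0 k) (P k) (2 * tau) = phi0 k /\
               closed_flux (phi0 k) (P k) (4 * tau) = phi0 k.
  apply: closed_flux_revisit; [exact: ltW | by rewrite -hT | |].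
    by apply: P_odd; left.
  by apply: P_odd; right.
split.
- exists (closed_signals L sigma (derive1 g) phi0 u).
  exact: closed_signals_solution.
- move=> X Y /(solution_closed_signals hS) eqX.
  move=> /(solution_closed_signals hS) eqY t tT.
  have [fX cX pX oX] := eqX t tT; have [fY cY pY oY] := eqY t tT.
  by split=> [k kL|k kL|l lL|]; rewrite ?oX ?fX ?cX ?pX // ?fY ?cY ?pY.
- move=> X /(solution_closed_signals hS) eqX; split=> [|k kL].
  + rewrite /Lambda_dec (_ : T / 2 = 2 * tau); last lra.
    have [|_ _ _ ->] := eqX (2 * tau); first by apply/andP; split; lra.
    rewrite /= (closed_potential_ann hphi0) => [|k _]; last by case: (fluxE k).
    by rewrite /u hT Lambda_enc_mid.
  + have [|-> // _ _ _] := eqX T; first by rewrite T0 lexx.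
    by rewrite /= hT; case: (fluxE k).
Qed.
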